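(* Suppose the linear mapping $\Omega[\cdot]$, $\Omega[\rho]_i=\sum_{k\in\mathcal N_i}\omega_{ik}\rho_k$, is self-adjoint with respect to the canonical matrix inner product, i.e. $\langle\mu,\Omega[\rho]\rangle=\langle\Omega[\mu],\rho\rangle$ for all $\mu,\rho$. Then the solution $\mu(t)\in\mathcal Q_c$ to $$\dot\mu=\mathfrak R_\mu\big[\Omega[\mu]\big],\qquad \mu(0)=S(\mathbb 1_{\mathcal Q_c}),$$ also solves the Riemannian gradient descent equation $$\dot\mu=-\operatorname{grad}_\mu J(\mu),\qquad\text{with}\qquad \big(\operatorname{grad}_\mu J(\mu)\big)_i=\operatorname{grad}_{\mu_i}J(\mu),\quad i\in\mathcal V,$$ with respect to the potential $$J(\mu):=-\tfrac12\langle\mu,\Omega[\mu]\rangle .$$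
   Context: Fix $c\in\mathbb N$. $\mathcal H_c=\{X\in\mathbb C^{c\times c}: X^*=X\}$, $\mathcal H_{c,0}=\{X\in\mathcal H_c:\operatorname{tr}X=0\}$, $\mathcal D_c=\{\rho\in\mathcal H_c:\rho\succ0,\ \operatorname{tr}\rho=1\}$, with tangent spaces $T_\rho\mathcal D_c=\mathcal H_{c,0}$, equipped with the Bogoliubov-Kubo-Mori (BKM) metric $g_\rho(X,Y)=\int_0^\infty\operatorname{tr}\big(X(\rho+\lambda I)^{-1}Y(\rho+\lambda I)^{-1}\big)d\lambda$. $\langle A,B\rangle=\operatorname{tr}(AB)$ on $\mathcal H_c$. For $\rho\in\mathcal D_c$, $X\in\mathcal H_c$: $\mathbb T_\rho^{-1}[X]=\int_0^1\rho^{1-\lambda}X\rho^\lambda d\lambda$ and the replicator map is $\mathfrak R_\rho[X]=\mathbb T_\rho^{-1}[X]-\langle\rho,X\rangle\rho$. Graph: $\mathcal G=(\mathcal V,\mathcal E,\omega)$ is a finite weighted graph, $\mathcal N_i=\{i\}\cup\{k\in\mathcal V: ik\in\mathcal E\}$, $\omega_{ik}\ge0$, $\omega_{ik}=0$ if $k\notin\mathcal N_i$, $\sum_{k\in\mathcal N_i}\omega_{ik}=1$ for all $i$. $\mathcal Q_c=\prod_{i\in\mathcal V}\mathcal D_c$, with product metric $g_\rho(X,Y)=\sum_{i\in\mathcal V}g_{\rho_i}(X_i,Y_i)$; $\operatorname{grad}$ denotes the Riemannian gradient with respect to this metric, and $\operatorname{grad}_{\mu_i}$ the Riemannian gradient on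 $\mathcal D_c$ (BKM metric) with respect to the $i$-th factor. For $\mu,\rho\in\prod_{i\in\mathcal V}\mathcal H_c$, $\langle\mu,\rho\rangle=\sum_{i\in\mathcal V}\langle\mu_i,\rho_i\rangle$. $\mathfrak R_\mu$ acts factorwise: $\mathfrak R_\mu[X]_i=\mathfrak R_{\mu_i}[X_i]$. $\mathbb 1_{\mathcal Q_c}=(\frac1cI_c)_{i\in\mathcal V}$. The initial point is $S(\mathbb 1_{\mathcal Q_c})$, where for given data matrices $D_i\in\mathcal H_c$, $i\in\mathcal V$, the similarity map $S\colon\mathcal Q_c\to\mathcal Q_c$ is explicitly $S_i(\rho)=\Gamma\big(\sum_{k\in\mathcal N_i}\omega_{ik}(\log_{\mathrm m}\rho_k-D_k)\big)$ with $\Gamma(X)=\exp_{\mathrm m}(X)/\operatorname{tr}\exp_{\mathrm m}(X)$, $X\in\mathcal H_c$ ($\exp_{\mathrm m},\log_{\mathrm m}$ matrix exponential and logarithm). *)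

(* Defs.v *)
From HB Require Import structures.
From mathcomp Require Export all_boot all_order all_algebra.
From mathcomp Require Export complex.
From mathcomp Require Export all_classical all_reals all_analysis.

Set Implicit Arguments.
Unset Strict Implicit.
Unset Printing Implicit Defensive.

Export Order.TTheory GRing.Theory Num.Theory.
Export numFieldNormedType.Exports.

#[export] Set Implicit Arguments.
#[export] Unset Strict Implicit.
#[export] Unset Printing Implicit Defensive.

Global Open Scope classical_set_scope.
Global Open Scope complex_scope.
Global Open Scope sesquilinear_scope.
Global Open Scope ring_scope.

Section MatrixAnalysis.
Variables (R : realType) (c : nat).
Local Notation mat := 'M[R[i]]_c.

Definition herm : set mat := [set X | X \is hermsymmx].

Definition herm0 : set mat := [set X | herm X /\ \tr X = 0].

(* In R[i], [0 < z] says that z is real and positive. *)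
Definition posdef (X : mat) : Prop :=
  herm X /\ forall v : 'cV[R[i]]_c, v != 0 -> 0 < (v^t* *m X *m v) 0 0.

Definition density : set mat := [set X | posdef X /\ \tr X = 1].

(* tr (A B) is real for Hermitian A and B, so taking the real part only
   retypes it. *)
Definition mxip (A B : mat) : R := complex.Re (\tr (A *m B)).

(* Functional calculus: sum of f(l) P_l over the spectral decomposition
   sum of l P_l of the Hermitian matrix X.  Its eigenvalues are real. *)
Definition hermfun (f : R -> R) (X : mat) : mat :=
  invmx (spectralmx X)
    *m diag_mx (map_mx (fun z : R[i] => (f (complex.Re z))%:C) (spectral_diag X))
    *m spectralmx X.

(* Limits, integrals and derivatives of matrix-valued functions of a real
   argument are taken on the real and imaginary parts of the entries. *)

Definition mxexp (X : mat) : mat :=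
  let u (p : R[i] -> R) i j : R^nat :=
    fun n => p ((\sum_(k < n) (k`!%:R)^-1 *: X ^+ k : mat) i j) in
  \matrix_(i, j) (limn (u (@complex.Re R) i j) +i* limn (u (@complex.Im R) i j)).

Definition mxlog (X : mat) : mat := hermfun (@ln R) X.

Definition mxpow (X : mat) (l : R) : mat := hermfun (fun x => x `^ l) X.

Definition mxint (D : set R) (F : R -> mat) : mat :=
  \matrix_(i, j)
    ((\int[@lebesgue_measure R]_(l in D) complex.Re (F l i j))
     +i* (\int[@lebesgue_measure R]_(l in D) complex.Im (F l i j))).

(* Difference quotients only use times in I, so the derivative is one-sided
   at an end point of an interval I. *)
Definition deriv_within (I : set R) (f : R -> R) (t l : R) : Prop :=
  h^-1 * (f (t + h) - f t) @[h --> within [set h | I (t + h)] 0^'] --> l.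

Definition mxderiv_within (I : set R) (F : R -> mat) (t : R) (L : mat) : Prop :=
  forall i j,
    deriv_within I (fun s => complex.Re (F s i j)) t (complex.Re (L i j)) /\
    deriv_within I (fun s => complex.Im (F s i j)) t (complex.Im (L i j)).

Definition bkm (rho X Y : mat) : R :=
  let res (l : R) := invmx (rho + l%:C%:M) in
  \int[@lebesgue_measure R]_(l in `[0, +oo[)
    complex.Re (\tr (X *m res l *m Y *m res l)).

Definition Tinv (rho X : mat) : mat :=
  mxint `[0, 1] (fun l => mxpow rho (1 - l) *m X *m mxpow rho l).

Definition replicator (rho X : mat) : mat :=
  Tinv rho X - (mxip rho X)%:C *: rho.

Definition Gamma (X : mat) : mat := (\tr (mxexp X))^-1 *: mxexp X.

End MatrixAnalysis.

Section Gradient.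
Variables (R : realType) (M : Type).

(* P is a manifold, T its tangent space (the same at all points, as for an
   open subset of an affine space), g its metric, and [cderiv F t Y] says that
   the curve F has velocity Y at time t.  G is the gradient of f at p iff
   df_p(Y) = g_p(G, Y) for all tangent Y, where df_p(Y) is the derivative of f
   along curves in P through p with velocity Y. *)
Definition is_rgrad (P T : set M) (g : M -> M -> M -> R)
    (cderiv : (R -> M) -> R -> M -> Prop) (f : M -> R) (p G : M) : Prop :=
  T G /\
  forall Y, T Y -> forall F : R -> M,
    F 0 = p -> (\forall s \near (0 : R), P (F s)) -> cderiv F 0 Y ->
    is_derive (0 : R) 1 (f \o F) (g p G Y).

End Gradient.

Section DensityManifold.
Variables (R : realType) (c : nat).
Local Notation mat := 'M[R[i]]_c.

Definition is_grad_density (f : mat -> R) (rho G : mat) : Prop :=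
  is_rgrad (@density R c) (@herm0 R c) (@bkm R c)
    (@mxderiv_within R c setT) f rho G.

Definition grad_density (f : mat -> R) (rho : mat) : mat :=
  xget 0 (is_grad_density f rho).

End DensityManifold.

Section ProductManifold.
Variables (R : realType) (c : nat) (V : finType).
Local Notation mat := 'M[R[i]]_c.
Local Notation field := (V -> mat).

Definition hermQ : set field := [set X | forall i, herm (X i)].

Definition herm0Q : set field := [set X | forall i, herm0 (X i)].

Definition densityQ : set field := [set rho | forall i, density (rho i)].

Definition ipQ (mu rho : field) : R := \sum_i mxip (mu i) (rho i).

Definition bkmQ (rho X Y : field) : R := \sum_i bkm (rho i) (X i) (Y i).

Definition derivQ_within (I : set R) (F : R -> field) (t : R) (L : field) :
    Prop :=
  forall i, mxderiv_within I (fun s => F s i) t (L i).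

Definition replicatorQ (mu X : field) : field :=
  fun i => replicator (mu i) (X i).

Definition barycenterQ : field := fun=> (c%:R^-1)%:M.

Definition is_gradQ (f : field -> R) (rho G : field) : Prop :=
  is_rgrad densityQ herm0Q bkmQ (derivQ_within setT) f rho G.

Definition gradQ (f : field -> R) (rho : field) : field :=
  xget (fun=> 0) (is_gradQ f rho).

(* The function of the i-th factor obtained by freezing the others at mu. *)
Definition slice (f : field -> R) (mu : field) (i : V) : mat -> R :=
  fun nu => f (@dfwith V (fun=> mat) mu i nu).

End ProductManifold.

Section Graph.
Variables (R : realType) (c : nat) (V : finType).
Local Notation mat := 'M[R[i]]_c.
Local Notation field := (V -> mat).

Definition nbhd (E : rel V) (i : V) : {set V} := i |: [set k | E i k]%SET.

Definition Omega (E : rel V) (w : V -> V -> R) (rho : field) : field :=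
  fun i => \sum_(k in nbhd E i) (w i k)%:C *: rho k.

Definition similarity (E : rel V) (w : V -> V -> R) (D rho : field) : field :=
  fun i => Gamma (\sum_(k in nbhd E i) (w i k)%:C *: (mxlog (rho k) - D k)).

Definition potential (E : rel V) (w : V -> V -> R) (mu : field) : R :=
  - (2^-1 * ipQ mu (Omega E w mu)).

End Graph.

(* Main.v *)
From mathcomp Require Import measurable_realfun ring.
Require Import Defs.

(** Why the theorem holds.  The replicator map is the inverse of the BKM metric
    composed with the projection onto trace-free matrices.  Precisely, for a
    density matrix rho, X Hermitian and Y Hermitian of trace zero,

      g_rho (R_rho [X], Y) = <X, Y>                        ([bkm_replicator]).

    Both sides are computed in an eigenbasis of rho, with eigenvalues l_a > 0
    and X', Y' the matrices of X, Y in that basis.  There T_rho^-1 multiplies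
    the entry (a, b) by the integral of l_a^(1-x) l_b^x over [0, 1], which is
    the logarithmic mean L(l_a, l_b) ([geodesic_integral], [TinvE]), while the
    BKM metric weights X'_ab Y'_ba by the integral of 1 / ((x+l_a) (x+l_b)) over
    [0, +oo[, which is 1 / L(l_a, l_b) ([resolvent_integral], [bkmE]).  The
    weights cancel, and the correction - <rho, X> rho of the replicator map
    contributes - <rho, X> tr Y = 0.

    Since Omega is self-adjoint, the derivative of J at nu in a direction Y is
    - <Omega [nu], Y>, so the identity above says that - R_nu [Omega [nu]] is a
    gradient of J at nu ([is_gradQ_potential]).

    Gradients are unique.  On one factor, a tangent vector G is determined by
    the numbers g_rho (G, Y): by symmetry g_rho (G, R_rho [X]) = <X, G>, and
    R_rho [X] is tangent, so these numbers determine <X, G> for all Hermitian X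
    ([bkm_inj]).  These numbers are derivatives along curves, and there are
    enough curves because the density matrices are open in the affine space of
    Hermitian matrices of trace one ([density_line]).  The components of a
    gradient on the product are gradients of the slices
    ([is_gradQ_slice]), which gives uniqueness on the product as well as the
    factorwise description of the gradient.

    Hence grad J (mu t) = - R_(mu t) [Omega [mu t]] at all times, and the two
    flows have the same right-hand side. *)

(** * The logarithmic mean as two integrals *)

Section Scalar.
Variable R : realType.
Implicit Types a b x : R.
Local Notation leb := (@lebesgue_measure R).

Lemma is_derive_continuous (f : R -> R) x d :
  is_derive x 1 f d -> {for x, continuous f}.
Proof.
move=> df; apply/differentiable_continuous/derivable1_diffP.
exact: ex_derive.
Qed.

(** For a nonnegative integrand the finite value of the integral amounts to
    integrability, which linearity of the integral will need. *)
Lemma improper_FTC (f F : R -> R) l :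
  (forall x, 0 <= x -> 0 <= f x) ->
  (forall x, 0 <= x -> {for x, continuous f}) ->
  (forall x, 0 <= x -> is_derive x 1 F (f x)) ->
  F x @[x --> +oo] --> l ->
  leb.-integrable `[0, +oo[ (EFin \o f) /\
  \int[leb]_(x in `[0, +oo[) f x = l - F 0.
Proof.
move=> f0 fc dF Fl.
have cf : {within `[0, +oo[, continuous f}.
  apply: continuous_in_subspaceT => x.
  by rewrite inE/= in_itv/= andbT; exact: fc.
have I : (\int[leb]_(x in `[0%R, +oo[) (f x)%:E = l%:E - (F 0)%:E)%E.
  apply: ge0_continuous_FTC2y => //.
  - by move=> x /ltW x0; have := dF x x0; case.
  - apply: cvg_at_right_filter; apply: is_derive_continuous (dF _ _).
    exact: lexx.
  - move=> x; rewrite in_itv/= andbT => /ltW x0.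
    by rewrite derive1E; have := dF x x0; case.
split; last by rewrite /Rintegral I -EFinB.
apply/integrableP; split.
  by apply/measurable_EFinP; exact: subspace_continuous_measurable_fun.
under eq_integral.
  move=> x; rewrite inE/= in_itv/= andbT => x0.
  by rewrite ger0_norm ?f0//; over.
by rewrite I -EFinB ltry.
Qed.

Lemma segment_FTC (f F : R -> R) :
  continuous f -> (forall x, is_derive x 1 F (f x)) ->
  leb.-integrable `[0, 1] (EFin \o f) /\
  \int[leb]_(x in `[0, 1]) f x = F 1 - F 0.
Proof.
move=> fc dF.
have cF : continuous F by move=> x; apply: is_derive_continuous (dF x).
have cf : {within `[0, 1], continuous f} by exact: continuous_subspaceT.
split.
  by apply: continuous_compact_integrable => //; exact: segment_compact.
rewrite /Rintegral (@continuous_FTC2 _ f F) ?EFinB//.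
- split; first by move=> x _; have := dF x; case.
  + by apply: cvg_at_right_filter; exact: cF.
  + by apply: cvg_at_left_filter; exact: cF.
- by move=> x _; rewrite derive1E; have := dF x; case.
Qed.

(** The logarithmic mean of two positive numbers, extended by continuity to the
    diagonal. *)
Definition logmean a b : R :=
  if a == b then a else (a - b) / (ln a - ln b).

Lemma logmean_diag a : logmean a a = a.
Proof. by rewrite /logmean eqxx. Qed.

Lemma logmeanC a b : logmean a b = logmean b a.
Proof.
rewrite /logmean eq_sym; case: eqVneq => // _.
by rewrite -[b - a]opprB -[ln b - _]opprB invrN mulrNN.
Qed.

Lemma ln_neq a b : 0 < a -> 0 < b -> a != b -> ln a - ln b != 0.
Proof.
move=> a0 b0; apply: contra; rewrite subr_eq0 => /eqP.
by move=> /(ln_inj a0 b0) ->.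
Qed.

Lemma logmean_neq0 a b : 0 < a -> 0 < b -> logmean a b != 0.
Proof.
move=> a0 b0; rewrite /logmean; case: (eqVneq a b) => [_|ab].
  by rewrite gt_eqF.
by rewrite mulf_neq0 ?invr_eq0 ?ln_neq// subr_eq0.
Qed.

Lemma cvg_shift_inv_pinfty a : ((x + a)^-1) @[x --> +oo] --> (0 : R).
Proof.
have H := @gtr0_cvgV0 R _ +oo _ (fun x => x + a).
apply/H; last exact: cvg_addrr.
near=> x; rewrite -ltrBlDr sub0r.
near: x; apply: nbhs_pinfty_gt; exact: num_real.
Unshelve. all: by end_near. Qed.

(** Partial fractions give the primitive (ln (x + a) - ln (x + b)) / (b - a),
    which vanishes at infinity; on the diagonal the primitive is
    - 1 / (x + a). *)
Lemma resolvent_integral a b : 0 < a -> 0 < b ->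
  leb.-integrable `[0, +oo[ (EFin \o (fun x => ((x + a) * (x + b))^-1)) /\
  \int[leb]_(x in `[0, +oo[) ((x + a) * (x + b))^-1 = (logmean a b)^-1.
Proof.
move=> a0 b0.
have xp (c x : R) : 0 < c -> 0 <= x -> 0 < x + c.
  by move=> c0 x0; rewrite ltr_wpDl.
have f0 x : 0 <= x -> 0 <= ((x + a) * (x + b))^-1.
  by move=> x0; rewrite invr_ge0 mulr_ge0// ltW// xp.
have fc x : 0 <= x -> {for x, continuous (fun x => ((x + a) * (x + b))^-1)}.
  move=> x0; apply: cvgV; first by rewrite mulf_neq0 ?gt_eqF ?xp.
  by apply: cvgM; apply: cvgD => //; exact: cvg_cst.
have dD c (x : R) : is_derive x 1 (fun x => x + c) 1.
  by apply: is_derive_eq; rewrite addr0.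
have dln (c x : R) : 0 < c -> 0 <= x ->
    is_derive x 1 (fun x => ln (x + c)) (x + c)^-1.
  move=> c0 x0; have := is_derive1_ln (xp c x c0 x0) => dl.
  have := @is_derive1_comp _ _ (fun x => x + c) _ _ _ dl (dD c x).
  by rewrite mulr1.
have [ab|ab] := eqVneq a b.
- subst b; rewrite logmean_diag.
  have [||I ->] := @improper_FTC _ (fun x => - (x + a)^-1) 0 f0 fc.
  + move=> x x0.
    have xa0 : x + a != 0 by rewrite gt_eqF ?xp.
    have dV := @is_deriveV _ (fun x => x + a) _ _ _ xa0 (dD a x).
    apply: (is_derive_eq (is_deriveN dV)).
    by rewrite scaler1 opprK expr2.
  + by rewrite -oppr0; apply: cvgN; exact: cvg_shift_inv_pinfty.
  by rewrite !add0r opprK.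
rewrite /logmean (negbTE ab).
have [||I ->] := @improper_FTC _ (fun x => (ln (x + a) - ln (x + b)) / (b - a))
    0 f0 fc.
- move=> x x0.
  have := is_deriveM (is_deriveB (dln a x a0 x0) (dln b x b0 x0))
    (is_derive_cst (b - a)^-1 x 1) => dF.
  apply: (is_derive_eq dF); rewrite scaler0 add0r.
  have xa : x + a != 0 by rewrite gt_eqF ?xp.
  have xb : x + b != 0 by rewrite gt_eqF ?xp.
  have ba : b - a != 0 by rewrite subr_eq0 eq_sym.
  by rewrite /GRing.scale/=; field; rewrite xa xb ba.
- rewrite -[0](mul0r (b - a)^-1); apply: cvgMl.
  have E : \forall x \near +oo%R,
      1 + (a - b) * (x + b)^-1 = (x + a) / (x + b).
    near=> x; have x0 : 0 <= x by near: x; exact: nbhs_pinfty_ge.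
    by field; rewrite gt_eqF ?xp.
  have L : (x + a) / (x + b) @[x --> +oo] --> (1 : R).
    have : 1 + (a - b) * (x + b)^-1 @[x --> +oo] --> (1 + (a - b) * 0 : R).
      apply: cvgD; first exact: cvg_cst.
      by apply: cvgMr; exact: cvg_shift_inv_pinfty.
    by rewrite mulr0 addr0; exact: cvg_trans (near_eq_cvg E).
  have F : \forall x \near +oo%R,
      ln ((x + a) / (x + b)) = ln (x + a) - ln (x + b).
    near=> x; have x0 : 0 <= x by near: x; exact: nbhs_pinfty_ge.
    by rewrite ln_div ?posrE ?xp.
  apply: (cvg_trans (near_eq_cvg F)).
  have := continuous_cvg _ (continuous_ln (@ltr01 R)) L.
  by rewrite ln1; apply.
split=> //; rewrite !add0r invf_div -[b - a]opprB invrN mulrN opprK.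
Unshelve. all: by end_near. Qed.

(** The integrand is a exp (k x) with k = ln b - ln a, hence equal to the
    derivative of (a / k) exp (k x) when k <> 0 and to the constant a when
    a = b. *)
Lemma geodesic_integral a b : 0 < a -> 0 < b ->
  leb.-integrable `[0, 1] (EFin \o (fun x => a `^ (1 - x) * b `^ x)) /\
  \int[leb]_(x in `[0, 1]) (a `^ (1 - x) * b `^ x) = logmean a b.
Proof.
move=> a0 b0.
have E x : a `^ (1 - x) * b `^ x = a * expR (x * (ln b - ln a)).
  rewrite /powR !gt_eqF// mulrBl mul1r expRD lnK ?posrE// -mulrA -expRD.
  by congr (_ * expR _); ring.
have -> : (fun x => a `^ (1 - x) * b `^ x) =
    (fun x => a * expR (x * (ln b - ln a))) by apply/funext.
have cE k : continuous (fun x : R => a * expR (x * k)).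
  move=> x; apply: cvgMr.
  apply: (continuous_comp (f := fun x : R => x * k)); first exact: cvgMl.
  exact: continuous_expR.
have [ab|ab] := eqVneq a b.
  subst b; rewrite logmean_diag.
  have [|-> I] := @segment_FTC _ (fun x => x * a) (cE (ln a - ln a)).
  - move=> x; rewrite subrr mulr0 expR0 mulr1.
    have := is_deriveM (is_derive_id x 1) (is_derive_cst a x 1) => dF.
    by apply: (is_derive_eq dF); rewrite scaler0 add0r /GRing.scale/= mulr1.
  by rewrite I mul1r mul0r subr0.
rewrite /logmean (negbTE ab).
have k0 : ln b - ln a != 0 by rewrite ln_neq// eq_sym.
set k := ln b - ln a in k0 *.
have [|-> I] := @segment_FTC _ (fun x => a / k * expR (x * k)) (cE k).
- move=> x.
  have dk : is_derive x 1 (fun x : R => x * k) k.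
    have := is_deriveM (is_derive_id x 1) (is_derive_cst k x 1) => dF.
    by apply: (is_derive_eq dF); rewrite scaler0 add0r /GRing.scale/= mulr1.
  have := is_derive1_comp (g := fun x : R => x * k) (is_derive_expR _) dk => dE.
  have := is_deriveM (is_derive_cst (a / k) x 1) dE => dF.
  apply: (is_derive_eq dF); rewrite scaler0 addr0 /GRing.scale/=.
  by field.
rewrite I; split=> //.
rewrite mul1r mul0r expR0 expRB !lnK ?posrE// -[ln a - ln b]opprB -/k.
by field; rewrite k0 gt_eqF.
Qed.
End Scalar.

(** * Real and imaginary parts; linear combinations of integrals *)

Section ReIm.
Variable R : realType.
Local Notation C := R[i].
Local Notation Re := (@complex.Re R).
Local Notation Im := (@complex.Im R).

Lemma Re_sum (I : Type) (r : seq I) (P : pred I) (F : I -> C) :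
  Re (\sum_(i <- r | P i) F i) = \sum_(i <- r | P i) Re (F i).
Proof. by apply: (big_morph Re (id1 := 0)) => // -[a b] [a' b']. Qed.

Lemma Im_sum (I : Type) (r : seq I) (P : pred I) (F : I -> C) :
  Im (\sum_(i <- r | P i) F i) = \sum_(i <- r | P i) Im (F i).
Proof. by apply: (big_morph Im (id1 := 0)) => // -[a b] [a' b']. Qed.

Lemma ReMr (z : C) (x : R) : Re (z * x%:C) = Re z * x.
Proof. by case: z => a b /=; rewrite mulr0 subr0. Qed.

Lemma ImMr (z : C) (x : R) : Im (z * x%:C) = Im z * x.
Proof. by case: z => a b /=; rewrite mulr0 add0r. Qed.

Lemma conjcMr (z : C) (x : R) : (z * x%:C)^*%C = z^*%C * x%:C.
Proof. by case: z => a b /=; congr (_ +i* _); ring. Qed.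
End ReIm.

Lemma Rintegral_lincomb (d : measure_display) (T : measurableType d)
    (R : realType) (m : {measure set T -> \bar R}) (I : finType) (D : set T)
    (c : I -> R) (f : I -> T -> R) :
  measurable D -> (forall i, m.-integrable D (EFin \o f i)) ->
  \int[m]_(x in D) (\sum_i c i * f i x) =
  \sum_i c i * \int[m]_(x in D) f i x.
Proof.
move=> mD fi.
have ci i : m.-integrable D (EFin \o (fun x => c i * f i x)).
  exact: (integrableZl mD (c i) (fi i)).
suff J (r : seq I) :
    m.-integrable D (EFin \o (fun x => \sum_(i <- r) c i * f i x)) /\
       \int[m]_(x in D) (\sum_(i <- r) c i * f i x) =
       \sum_(i <- r) c i * \int[m]_(x in D) f i x.
  by have [] := J (index_enum I).
elim: r => [|i r [IH1 IH2]].
  rewrite (_ : (fun x => _) = cst 0); last first.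
    by apply/funext => x /=; rewrite big_nil.
  by split; [exact: integrable0|rewrite Rintegral_cst// mul0r big_nil].
rewrite (_ : (fun x => _) = (fun x => c i * f i x + \sum_(j <- r) c j * f j x));
  last by apply/funext => x; rewrite big_cons.
split; first exact: (integrableD mD (ci i) IH1).
by rewrite RintegralD// IH2 big_cons RintegralZl.
Qed.

(** * The metric and the replicator map in an eigenbasis *)

Section Spectral.
Variables (R : realType) (c : nat).
Local Notation C := R[i].
Local Notation mat := 'M[C]_c.
Local Notation Re := (@complex.Re R).
Local Notation Im := (@complex.Im R).
Implicit Types (X Y rho : mat) (d : 'I_c -> R).

Lemma hermE X : herm X <-> X = X^t*.
Proof.
by split=> [/is_hermitianmxP|H]; last apply/is_hermitianmxP;
  rewrite expr0 scale1r.
Qed.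

Definition rdiag d : mat := diag_mx (\row_i (d i)%:C).

(** [rot rho] passes to the coordinates of the eigenbasis of rho, [unrot rho]
    comes back.  The adjoint of the unitary [spectralmx rho] replaces its
    inverse so that hermiticity is visibly preserved. *)
Definition unrot rho X : mat := (spectralmx rho)^t* *m X *m spectralmx rho.
Definition rot rho X : mat := spectralmx rho *m X *m (spectralmx rho)^t*.
Definition ev rho (i : 'I_c) : R := Re (spectral_diag rho 0 i).

Lemma invmx_spectralmx rho : invmx (spectralmx rho) = (spectralmx rho)^t*.
Proof. exact/invmx_unitary/spectral_unitarymx. Qed.

Lemma spectral_mulVmx rho : (spectralmx rho)^t* *m spectralmx rho = 1%:M.
Proof. by rewrite -invmx_spectralmx mulVmx// spectral_unit. Qed.

Lemma spectral_mulmxV rho : spectralmx rho *m (spectralmx rho)^t* = 1%:M.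
Proof. exact/unitarymxP/spectral_unitarymx. Qed.

Lemma rotK rho : cancel (rot rho) (unrot rho).
Proof.
move=> X; rewrite /unrot /rot !mulmxA spectral_mulVmx mul1mx -mulmxA.
by rewrite spectral_mulVmx mulmx1.
Qed.

Lemma unrotK rho : cancel (unrot rho) (rot rho).
Proof.
move=> X; rewrite /unrot /rot !mulmxA spectral_mulmxV mul1mx -mulmxA.
by rewrite spectral_mulmxV mulmx1.
Qed.

Lemma rotM rho X Y : rot rho (X *m Y) = rot rho X *m rot rho Y.
Proof.
rewrite /rot !mulmxA; congr (_ *m _ *m _).
by rewrite -[_ *m _ *m spectralmx _]mulmxA spectral_mulVmx mulmx1.
Qed.

Lemma unrotM rho X Y : unrot rho (X *m Y) = unrot rho X *m unrot rho Y.
Proof. by rewrite -[RHS](rotK rho) rotM !unrotK. Qed.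

Lemma rotD rho X Y : rot rho (X + Y) = rot rho X + rot rho Y.
Proof. by rewrite /rot mulmxDr mulmxDl. Qed.

Lemma rotB rho X Y : rot rho (X - Y) = rot rho X - rot rho Y.
Proof. by rewrite /rot mulmxBr mulmxBl. Qed.

Lemma rotZ rho (a : C) X : rot rho (a *: X) = a *: rot rho X.
Proof. by rewrite /rot -scalemxAr -scalemxAl. Qed.

Lemma tr_rot rho X : \tr (rot rho X) = \tr X.
Proof. by rewrite /rot mxtrace_mulC mulmxA spectral_mulVmx mul1mx. Qed.

Lemma tr_unrot rho X : \tr (unrot rho X) = \tr X.
Proof. by rewrite -(tr_rot rho) unrotK. Qed.

Lemma herm_unrot rho X : herm X -> herm (unrot rho X).
Proof.
move=> /hermE hX; apply/hermE.
by rewrite /unrot !trmx_mul !map_mxM trmxCK -hX mulmxA.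
Qed.

Lemma herm_rot rho X : herm X -> herm (rot rho X).
Proof.
move=> /hermE hX; apply/hermE.
by rewrite /rot !trmx_mul !map_mxM trmxCK -hX mulmxA.
Qed.

Lemma rot_herm rho : herm rho -> rot rho rho = rdiag (ev rho).
Proof.
move=> h; rewrite -[RHS](unrotK rho); congr rot.
have -> : rdiag (ev rho) = diag_mx (spectral_diag rho).
  congr diag_mx; apply/rowP => i; rewrite mxE /ev RRe_real//.
  by have /mxOverP := hermitian_spectral_diag_real h; apply.
rewrite /unrot -invmx_spectralmx.
exact/orthomx_spectralP/hermitian_normalmx.
Qed.

Lemma hermfunE (f : R -> R) rho :
  hermfun f rho = unrot rho (rdiag (f \o ev rho)).
Proof.
have -> : rdiag (f \o ev rho) =
    diag_mx (map_mx (fun z : C => (f (Re z))%:C) (spectral_diag rho)).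
  by congr diag_mx; apply/rowP => i; rewrite !mxE.
by rewrite /unrot -invmx_spectralmx.
Qed.

(** The quadratic form of rho at the i-th eigenvector is the i-th eigenvalue. *)
Lemma ev_gt0 rho i : posdef rho -> 0 < ev rho i.
Proof.
move=> [h pos].
pose v : 'cV[C]_c := (spectralmx rho)^t* *m delta_mx i 0.
have v0 : v != 0.
  apply: contraNneq (oner_neq0 C) => v0.
  have : spectralmx rho *m v = 0 by rewrite v0 mulmx0.
  rewrite mulmxA spectral_mulmxV mul1mx => /matrixP/(_ i 0).
  by rewrite !mxE !eqxx/= mulr1n => ->.
have := pos v v0.
have E : rho = unrot rho (rdiag (ev rho)) by rewrite -rot_herm// rotK.
rewrite [X in _ *m X *m _]E /v trmx_mul map_mxM trmxCK /unrot.
rewrite !mulmxA -[_ *m _ *m (spectralmx rho)^t*]mulmxA spectral_mulmxV mulmx1.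
rewrite -[_ *m _ *m (spectralmx rho)^t*]mulmxA spectral_mulmxV mulmx1.
rewrite mul_mx_diag !mxE (bigD1 i)//= big1 => [|j ji]; last first.
  by rewrite !mxE (negbTE ji) mulr0.
rewrite !mxE !eqxx/= rmorph1 mul1r addr0 mulr1.
by rewrite ltcE/= => /andP[].
Qed.

Lemma rdiagE d a b : rdiag d a b = (d a)%:C *+ (a == b).
Proof. by rewrite !mxE. Qed.

Lemma mul_rdiag d X a b : (rdiag d *m X) a b = X a b * (d a)%:C.
Proof. by rewrite mul_diag_mx !mxE mulrC. Qed.

Lemma mulmx_rdiag d X a b : (X *m rdiag d) a b = X a b * (d b)%:C.
Proof. by rewrite mul_mx_diag !mxE. Qed.

Lemma resolventE rho (l : R) : posdef rho -> 0 <= l ->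
  invmx (rho + l%:C%:M) = unrot rho (rdiag (fun i => (l + ev rho i)^-1)).
Proof.
move=> pd l0; set A := rho + _; set B := unrot _ _.
have E : rot rho A = rdiag (fun i => l + ev rho i).
  rewrite /A -[l%:C%:M]opprK rotB rot_herm//; last by case: pd.
  have -> : rot rho (- l%:C%:M) = - l%:C%:M.
    rewrite /rot mulmxN mulNmx scalar_mxC -mulmxA spectral_mulmxV.
    by rewrite mulmx1.
  apply/matrixP => a b; rewrite !mxE; case: (eqVneq a b) => _.
    by rewrite !mulr1n opprK addrC rmorphD.
  by rewrite !mulr0n oppr0 subr0.
have BA : B *m A = 1%:M.
  rewrite -(rotK rho A) E -unrotM.
  rewrite -[RHS](rotK rho); congr unrot; rewrite /rot mulmx1 spectral_mulmxV.
  apply/matrixP => a b; rewrite mul_rdiag !mxE.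
  case: (eqVneq a b) => [->|_]; last by rewrite !mulr0n mul0r.
  rewrite !mulr1n -rmorphM mulfV// gt_eqF// ltr_wpDl//.
  exact: ev_gt0.
have [_ uA] := mulmx1_unit BA.
by rewrite -[B](mulmxK uA) BA mul1mx.
Qed.

(** In the eigenbasis the resolvents are diagonal, so the integrand is a finite
    combination of the functions of [resolvent_integral]. *)
Lemma bkmE rho X Y : posdef rho ->
  bkm rho X Y = \sum_a \sum_b
    Re (rot rho X a b * rot rho Y b a) * (logmean (ev rho a) (ev rho b))^-1.
Proof.
move=> pd; rewrite /bkm pair_big/=.
pose f (p : 'I_c * 'I_c) x := ((x + ev rho p.1) * (x + ev rho p.2))^-1.
transitivity (\int[@lebesgue_measure R]_(l in `[0, +oo[)
    \sum_(p : 'I_c * 'I_c) Re (rot rho X p.1 p.2 * rot rho Y p.2 p.1) * f p l).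
  apply: eq_Rintegral => l; rewrite inE/= in_itv/= andbT => l0.
  have := unrotK rho (rdiag (fun i => (l + ev rho i)^-1)).
  rewrite -resolventE//; move: (invmx _) => S SE.
  rewrite -(tr_rot rho) !rotM SE /mxtrace Re_sum.
  rewrite -(pair_big xpredT xpredT (fun a b =>
    Re (rot rho X a b * rot rho Y b a) * f (a, b) l))/=.
  apply: eq_bigr => a _; rewrite mulmx_rdiag [(_ *m rot rho Y) a a]mxE.
  rewrite mulr_suml Re_sum.
  apply: eq_bigr => b _; rewrite mulmx_rdiag.
  rewrite -!mulrA [_%:C * (_ * _)]mulrCA -rmorphM mulrA ReMr; congr (_ * _).
  by rewrite /f invfM mulrC.
rewrite Rintegral_lincomb//; last first.
  by move=> p; have [] := resolvent_integral (ev_gt0 p.1 pd) (ev_gt0 p.2 pd).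
apply: eq_bigr => p _; congr (_ * _).
by have [] := resolvent_integral (ev_gt0 p.1 pd) (ev_gt0 p.2 pd).
Qed.

(** In the eigenbasis the powers of rho are diagonal, so the integrand is a
    finite combination of the functions of [geodesic_integral]: T_rho^-1 is a
    Schur product with the logarithmic means of the eigenvalues. *)
Lemma TinvE rho X : posdef rho ->
  Tinv rho X = unrot rho (\matrix_(a, b)
    (rot rho X a b * (logmean (ev rho a) (ev rho b))%:C)).
Proof.
move=> pd; apply/matrixP => i j; rewrite /Tinv /mxint mxE.
pose P := spectralmx rho.
pose f (p : 'I_c * 'I_c) x := ev rho p.1 `^ (1 - x) * ev rho p.2 `^ x.
pose z (p : 'I_c * 'I_c) := P^t* i p.1 * rot rho X p.1 p.2 * P p.2 j.
have E l : (mxpow rho (1 - l) *m X *m mxpow rho l) i j =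
    \sum_(p : 'I_c * 'I_c) z p * (f p l)%:C.
  rewrite /mxpow !hermfunE -{1}(rotK rho X) -!unrotM /unrot.
  rewrite mxE; under eq_bigr do rewrite mxE mulr_suml.
  rewrite exchange_big/= pair_big/=; apply: eq_bigr => -[a b] _ /=.
  by rewrite mulmx_rdiag mul_rdiag /z /f/= rmorphM/= -/P; ring.
have I p := geodesic_integral (ev_gt0 p.1 pd) (ev_gt0 p.2 pd).
have fi p : (@lebesgue_measure R).-integrable `[0, 1] (EFin \o f p).
  by have [] := I p.
rewrite [RHS](_ : _ = \sum_(p : 'I_c * 'I_c)
    z p * (logmean (ev rho p.1) (ev rho p.2))%:C); last first.
  rewrite /unrot mxE; under eq_bigr do rewrite mxE mulr_suml.
  rewrite exchange_big/= pair_big/=; apply: eq_bigr => -[a b] _ /=.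
  by rewrite mxE /z/= -/P mulrA mulrAC.
apply/eqP; rewrite eq_complex/= Re_sum Im_sum; apply/andP; split; apply/eqP.
- transitivity (\int[@lebesgue_measure R]_(l in `[0, 1])
      \sum_(p : 'I_c * 'I_c) Re (z p) * f p l).
    apply: eq_Rintegral => l _; rewrite E Re_sum.
    by apply: eq_bigr => p _; rewrite ReMr.
  rewrite Rintegral_lincomb//; apply: eq_bigr => p _; rewrite ReMr.
  by congr (_ * _); have [] := I p.
- transitivity (\int[@lebesgue_measure R]_(l in `[0, 1])
      \sum_(p : 'I_c * 'I_c) Im (z p) * f p l).
    apply: eq_Rintegral => l _; rewrite E Im_sum.
    by apply: eq_bigr => p _; rewrite ImMr.
  rewrite Rintegral_lincomb//; apply: eq_bigr => p _; rewrite ImMr.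
  by congr (_ * _); have [] := I p.
Qed.

Lemma hermP X : herm X <-> forall a b, X a b = (X b a)^*%C.
Proof.
split=> [/hermE {2}-> a b|H]; first by rewrite !mxE conjcK.
by apply/hermE/matrixP => a b; rewrite !mxE [LHS]H.
Qed.

Lemma herm_0 : herm (0 : mat).
Proof. by apply/hermP => a b; rewrite !mxE conjc0. Qed.

Lemma hermD X Y : herm X -> herm Y -> herm (X + Y).
Proof.
move=> /hermP hX /hermP hY; apply/hermP => a b.
by rewrite !mxE hX hY rmorphD.
Qed.

Lemma hermZ (x : R) X : herm X -> herm (x%:C *: X).
Proof.
by move=> /hermP hX; apply/hermP => a b; rewrite !mxE hX mulrC -conjcMr mulrC.
Qed.

Lemma hermN X : herm X -> herm (- X).
Proof. by move=> /hermP hX; apply/hermP => a b; rewrite !mxE hX rmorphN. Qed.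

Lemma mxip_real X Y : herm X -> herm Y -> (mxip X Y)%:C = \tr (X *m Y).
Proof.
move=> /hermE hX /hermE hY; rewrite /mxip RRe_real//; apply/CrealP.
have E : (X *m Y)^t* = Y *m X by rewrite trmx_mul map_mxM -hX -hY.
by have := trace_map_mx Num.conj (X *m Y)^T; rewrite E mxtrace_tr mxtrace_mulC.
Qed.

Lemma mxipC X Y : mxip X Y = mxip Y X.
Proof. by rewrite /mxip mxtrace_mulC. Qed.

Lemma bkmC rho X Y : bkm rho X Y = bkm rho Y X.
Proof.
rewrite /bkm; apply: eq_Rintegral => l _; congr Re.
rewrite -[LHS]mxtrace_mulC !mulmxA -[LHS]mxtrace_mulC !mulmxA.
by rewrite mxtrace_mulC !mulmxA.
Qed.

Lemma tr_mul_rot rho X : herm rho ->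
  \tr (rho *m X) = \sum_a rot rho X a a * (ev rho a)%:C.
Proof.
move=> hr; rewrite -(tr_rot rho) rotM rot_herm// /mxtrace.
by apply: eq_bigr => a _; rewrite mul_rdiag.
Qed.

(** Hermiticity comes from the symmetry of the logarithmic mean.  The trace
    vanishes because L(l_a, l_a) = l_a makes the trace of T_rho^-1 [X] equal to
    <rho, X>. *)
Lemma replicator_herm0 rho X :
  density rho -> herm X -> herm0 (replicator rho X).
Proof.
move=> [pd tr1] hX; have hr : herm rho by case: pd.
split.
  apply: hermD; last by apply: hermN; exact: hermZ.
  rewrite (TinvE _ pd); apply: herm_unrot; apply/hermP => a b.
  rewrite [LHS]mxE [in RHS]mxE.
  by rewrite conjcMr logmeanC; have /hermP <- := herm_rot rho hX.
rewrite /replicator linearB/= linearZ/= tr1 mulr1 (TinvE _ pd) tr_unrot.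
rewrite mxip_real// tr_mul_rot// /mxtrace.
apply/eqP; rewrite subr_eq0; apply/eqP.
by apply: eq_bigr => a _; rewrite mxE logmean_diag.
Qed.

(** The multipliers of the entries in [bkmE] and [TinvE] are inverse to each
    other.  The remaining term - <rho, X> rho pairs with Y to - <rho, X> tr Y,
    as 1 / l_a cancels the eigenvalue l_a. *)
Lemma bkm_replicator rho X Y : density rho -> herm0 Y ->
  bkm rho (replicator rho X) Y = mxip X Y.
Proof.
move=> [pd tr1] [hY trY]; rewrite (bkmE _ _ pd).
have hr : herm rho by case: pd.
set x := mxip rho X.
transitivity (Re (\tr (rot rho X *m rot rho Y)) -
    x * Re (\tr (rot rho Y))); last first.
  by rewrite -rotM !tr_rot trY mulr0 subr0.
have L a b : logmean (ev rho a) (ev rho b) != 0 by rewrite logmean_neq0 ?ev_gt0.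
(* The entry (a, b) of the pairing; rho only contributes on the diagonal. *)
have E a b : Re (rot rho (replicator rho X) a b * rot rho Y b a) /
    logmean (ev rho a) (ev rho b) =
    Re (rot rho X a b * rot rho Y b a) -
    (if b == a then x * Re (rot rho Y a a) else 0).
  rewrite /replicator rotB rotZ rot_herm// (TinvE _ pd) unrotK -/x.
  have -> (A B : mat) z : (A - z *: B) a b = A a b - z * B a b by rewrite !mxE.
  rewrite [(\matrix_(_, _) _) a b]mxE rdiagE.
  case: (eqVneq b a) => [->|ba].
    rewrite logmean_diag mulr1n.
    have e0 : ev rho a != 0 by rewrite gt_eqF ?ev_gt0.
    by case: (rot rho X a a) (rot rho Y a a) => u v [u' v'] /=; field.
  rewrite mulr0n mulr0 !subr0.
  by rewrite mulrAC ReMr mulfK.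
rewrite /mxtrace !Re_sum mulr_sumr -sumrB; apply: eq_bigr => a _.
under eq_bigr do rewrite E.
rewrite sumrB -big_mkcond big_pred1_eq; congr (_ - _).
by rewrite mxE Re_sum.
Qed.

Lemma mxipNr X Y : mxip X (- Y) = - mxip X Y.
Proof.
by rewrite /mxip mulmxN (_ : \tr (- _) = - \tr (X *m Y)) ?raddfN.
Qed.

Lemma replicatorN rho X :
  density rho -> replicator rho (- X) = - replicator rho X.
Proof.
move=> [pd _]; rewrite /replicator !(TinvE _ pd) opprB addrC mxipNr.
congr (_ + _).
  by rewrite rmorphN/= scaleNr opprK.
rewrite (_ : rot rho (- X) = - rot rho X); last by rewrite /rot mulmxN mulNmx.
move: (rot rho X) => X'; rewrite /unrot -mulNmx -mulmxN; congr (_ *m _ *m _).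
by apply/matrixP => a b; rewrite !mxE mulNr.
Qed.
End Spectral.

(** * Density matrices form an open set *)

Section Openness.
Variables (R : realType) (c : nat).
Local Notation C := R[i].
Local Notation mat := 'M[C]_c.
Implicit Types (X Y rho : mat).

Lemma herm_form_real X (u : 'cV[C]_c) : herm X ->
  (u^t* *m X *m u) 0 0 \is Num.real.
Proof.
move=> /hermE hX; apply/CrealP.
have {2}-> : u^t* *m X *m u = (u^t* *m X *m u)^t*.
  by rewrite !trmx_mul !map_mxM trmxCK -hX mulmxA.
by rewrite [in RHS]mxE [in RHS]mxE.
Qed.

Lemma form_sum X (u : 'cV[C]_c) :
  (u^t* *m X *m u) 0 0 = \sum_a \sum_b (u a 0)^* * X a b * u b 0.
Proof.
rewrite mxE exchange_big/=; apply: eq_bigr => b _.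
by rewrite mxE mulr_suml; apply: eq_bigr => a _; rewrite !mxE.
Qed.

(** By 2 |u_a| |u_b| <= |u_a|^2 + |u_b|^2 and the symmetry of the numbers
    |X_ab|, the form of X at u is at least minus the sum over a of the a-th
    absolute row sum of X times |u_a|^2. *)
Lemma diag_dominant_gt0 (d : 'I_c -> R) X (u : 'cV[C]_c) : herm X ->
  (forall a, \sum_b `|X a b| < (d a)%:C) -> u != 0 ->
  0 < (u^t* *m (rdiag d + X) *m u) 0 0.
Proof.
move=> hX dom u0.
rewrite mulmxDr mulmxDl mxE.
set z := (u^t* *m X *m u) 0 0.
have zR : z \is Num.real by exact: herm_form_real.
have -> : (u^t* *m rdiag d *m u) 0 0 = \sum_a (d a)%:C * `|u a 0| ^+ 2.
  rewrite form_sum; apply: eq_bigr => a _; rewrite (bigD1 a)//= big1.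
    by rewrite addr0 rdiagE eqxx mulr1n normCK mulrAC mulrC [u a 0 * _]mulrC.
  by move=> b ba; rewrite rdiagE eq_sym (negbTE ba) mulr0n mulr0 mul0r.
have zle : `|z| <= \sum_a (\sum_b `|X a b|) * `|u a 0| ^+ 2.
  have : `|z| <= \sum_a \sum_b `|X a b| * ((`|u a 0| ^+ 2 + `|u b 0| ^+ 2) / 2).
    rewrite /z form_sum; apply: le_trans (ler_norm_sum _ _ _) _.
    apply: ler_sum => a _; apply: le_trans (ler_norm_sum _ _ _) _.
    apply: ler_sum => b _; rewrite !normrM norm_conjC mulrAC mulrC ler_wpM2l//.
    rewrite ler_pdivlMr ?ltr0n// -subr_ge0.
    have -> : `|u a 0| ^+ 2 + `|u b 0| ^+ 2 - `|u a 0| * `|u b 0| * 2 =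
      (`|u a 0| - `|u b 0|) ^+ 2 by ring.
    by rewrite real_exprn_even_ge0// rpredB// normr_real.
  suff -> : \sum_a \sum_b `|X a b| * ((`|u a 0| ^+ 2 + `|u b 0| ^+ 2) / 2) =
    \sum_a (\sum_b `|X a b|) * `|u a 0| ^+ 2 by [].
  (* As |X_ab| = |X_ba|, both halves of the bound have the same sum. *)
  have E : \sum_a \sum_b `|X a b| * `|u b 0| ^+ 2 =
      \sum_a \sum_b `|X a b| * `|u a 0| ^+ 2.
    rewrite exchange_big/=; apply: eq_bigr => a _; apply: eq_bigr => b _.
    by move/hermP: hX => ->; rewrite -[X in `|X|]/(Num.conj _) norm_conjC.
  have F a b : `|X a b| * ((`|u a 0| ^+ 2 + `|u b 0| ^+ 2) / 2) =
      (`|X a b| * `|u a 0| ^+ 2 + `|X a b| * `|u b 0| ^+ 2) / 2.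
    by rewrite mulrA mulrDr.
  under eq_bigr do (under eq_bigr do rewrite F; rewrite -mulr_suml big_split/=).
  rewrite -mulr_suml big_split/= E mulrDl -splitr.
  by apply: eq_bigr => a _; rewrite mulr_suml.
have zN : - `|z| <= z.
  by have := lexx `|z|; rewrite real_ler_norml// => /andP[].
apply: lt_le_trans
  (_ : 0 < \sum_a ((d a)%:C - \sum_b `|X a b|) * `|u a 0| ^+ 2) _.
  have t0 a : 0 <= ((d a)%:C - \sum_b `|X a b|) * `|u a 0| ^+ 2.
    by rewrite mulr_ge0 ?exprn_ge0// subr_ge0 ltW.
  rewrite lt_def sumr_ge0// andbT psumr_eq0//; apply: contra u0 => /allP H.
  apply/eqP/matrixP => a j; rewrite ord1 mxE; apply/eqP.
  have := H a (mem_index_enum _); rewrite /= mulf_eq0 expf_eq0/= normr_eq0.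
  by rewrite subr_eq0 gt_eqF ?dom.
under eq_bigr do rewrite mulrBl.
rewrite sumrB; apply: lerD => //; apply: le_trans zN.
by rewrite lerN2.
Qed.

(** In the eigenbasis of rho a small multiple of Y is dominated by the positive
    diagonal of eigenvalues. *)
Lemma posdef_near rho Y : posdef rho -> herm Y ->
  \forall s \near (0 : R), posdef (rho + s%:C *: Y).
Proof.
move=> pd hY; have hr : herm rho by case: pd.
pose r a := complex.Re (\sum_b `|rot rho Y a b|).
have H a : \forall s \near (0 : R), `|s| * r a < ev rho a.
  have L : `|s| * r a @[s --> (0 : R)] --> `|0 : R| * r a.
    by apply: cvgMl; apply: cvg_norm; exact: cvg_id.
  by apply: cvgr_lt L _ _; rewrite normr0 mul0r ev_gt0.
apply: filterS (filter_forall _ H) => s sr; split.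
  exact: hermD hr (hermZ s hY).
move=> v v0.
rewrite -[rho + _](rotK rho) rotD rotZ rot_herm//.
rewrite /unrot -!mulmxA !mulmxA.
pose u := spectralmx rho *m v.
have -> : v^t* *m (spectralmx rho)^t* = u^t* by rewrite /u trmx_mul map_mxM.
rewrite -mulmxA; apply: diag_dominant_gt0.
- by apply: hermZ; exact: herm_rot.
- move=> a; under eq_bigr do rewrite mxE normrM.
  rewrite -mulr_sumr normc_def/= expr0n/= addr0 sqrtr_sqr.
  rewrite -[X in _ * X]RRe_real; last first.
    by apply: rpred_sum => b _; exact: normr_real.
  by rewrite -rmorphM ltcR sr.
- apply: contra v0 => /eqP u0; have := congr1 (mulmx ((spectralmx rho)^t*)) u0.
  by rewrite mulmx0 mulmxA spectral_mulVmx mul1mx => ->.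
Qed.
End Openness.

(** * Derivatives along curves *)

Section Calculus.
Variable R : realType.
Implicit Types f : R -> R.

Lemma deriv_withinTE f t l : deriv_within setT f t l <-> is_derive t 1 f l.
Proof.
rewrite /deriv_within (_ : [set h | setT (t + h)] = setT) ?withinET//.
have E : (fun h => h^-1 * (f (t + h) - f t)) =
    (fun h => h^-1 *: ((f \o shift t) (h *: (1 : R)) - f t)).
  by apply/funext => h; rewrite /= /GRing.scale/= mulr1 [t + h]addrC.
rewrite E; split=> [L|[dv <-]]; last exact: dv.
split; first by apply/cvg_ex; exists l.
exact: cvg_lim L.
Qed.

Lemma is_derive_bigsum (I : Type) (r : seq I) (P : pred I) (f : I -> R -> R)
    (df : I -> R) (t : R) : (forall i, is_derive t 1 (f i) (df i)) ->
  is_derive t 1 (fun s => \sum_(i <- r | P i) f i s) (\sum_(i <- r | P i) df i).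
Proof.
move=> d; rewrite [X in is_derive _ _ X _](_ : _ = \sum_(i <- r | P i) f i).
  by elim/big_ind2 : _ => // [|*]; [exact: is_derive_cst|exact: is_deriveD].
by apply/funext => s; rewrite fct_sumE.
Qed.
End Calculus.

Section Gradients.
Variables (R : realType) (c : nat) (V : finType).
Local Notation C := R[i].
Local Notation mat := 'M[C]_c.
Local Notation field := (V -> mat).
Local Notation Re := (@complex.Re R).
Local Notation Im := (@complex.Im R).

Lemma mxipE (A B : mat) :
  mxip A B = \sum_a \sum_b (Re (A a b) * Re (B b a) - Im (A a b) * Im (B b a)).
Proof.
rewrite /mxip /mxtrace Re_sum; apply: eq_bigr => a _.
rewrite mxE Re_sum; apply: eq_bigr => b _.
by case: (A a b) (B b a) => x y [x' y'].
Qed.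

Lemma is_derive_mxip (F G : R -> mat) t Y Z :
  mxderiv_within setT F t Y -> mxderiv_within setT G t Z ->
  is_derive t 1 (fun s => mxip (F s) (G s)) (mxip Y (G t) + mxip (F t) Z).
Proof.
move=> dF dG; rewrite !mxipE -big_split/=.
under eq_bigr do rewrite -big_split/=.
under eq_fun do rewrite mxipE.
apply: is_derive_bigsum => a; apply: is_derive_bigsum => b.
have [/deriv_withinTE dF1 /deriv_withinTE dF2] := dF a b.
have [/deriv_withinTE dG1 /deriv_withinTE dG2] := dG b a.
apply: (is_derive_eq (is_deriveB (is_deriveM dF1 dG1) (is_deriveM dF2 dG2))).
by rewrite /GRing.scale/=; ring.
Qed.

Lemma mxderiv_line (rho Y : mat) :
  mxderiv_within setT (fun s => rho + s%:C *: Y) 0 Y.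
Proof.
have dk (p q : R) : is_derive (0 : R) 1 (fun s => p + s * q) q.
  have := is_deriveM (is_derive_id (0 : R) 1) (is_derive_cst q (0 : R) 1) => dq.
  apply: (is_derive_eq (is_deriveD (is_derive_cst p (0 : R) 1) dq)).
  by rewrite scaler0 !add0r /GRing.scale/= mulr1.
move=> a b; split; apply/deriv_withinTE.
  rewrite (_ : (fun s => _) = (fun s => Re (rho a b) + s * Re (Y a b)))//.
  apply/funext => s; rewrite !mxE; case: (rho a b) (Y a b) => x y [x' y'] /=.
  by rewrite mul0r subr0.
rewrite (_ : (fun s => _) = (fun s => Im (rho a b) + s * Im (Y a b)))//.
apply/funext => s; rewrite !mxE; case: (rho a b) (Y a b) => x y [x' y'] /=.
by rewrite mul0r addr0.
Qed.

Lemma density_line rho (Y : mat) : density rho -> herm0 Y ->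
  \forall s \near (0 : R), density (rho + s%:C *: Y).
Proof.
move=> [pd tr1] [hY trY]; apply: filterS (posdef_near pd hY) => s pds.
by split=> //; rewrite linearD/= linearZ/= trY mulr0 addr0.
Qed.

(** * Uniqueness of gradients *)

Lemma herm_mxip_eq0 (X : mat) : herm X -> mxip X X = 0 -> X = 0.
Proof.
move=> /hermP hX; rewrite mxipE => X0.
have E a b : Re (X a b) * Re (X b a) - Im (X a b) * Im (X b a) =
    Re (X a b) ^+ 2 + Im (X a b) ^+ 2.
  by rewrite [X b a]hX; case: (X a b) => x y /=; ring.
apply/matrixP => a b; rewrite mxE; apply/eqP; rewrite eq_complex/=.
have := X0; under eq_bigr do (under eq_bigr do rewrite E).
have p0 a' b' : 0 <= Re (X a' b') ^+ 2 + Im (X a' b') ^+ 2.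
  by rewrite addr_ge0 ?sqr_ge0.
move=> /psumr_eq0P H.
have := H (fun i _ => sumr_ge0 _ (fun j _ => p0 i j)) a isT.
move=> /psumr_eq0P H'; have /eqP := H' (fun j _ => p0 a j) b isT.
by rewrite paddr_eq0 ?sqr_ge0// !sqrf_eq0.
Qed.

Lemma mxipBr (X A B : mat) : mxip X (A - B) = mxip X A - mxip X B.
Proof.
rewrite /mxip mulmxBr raddfB/=.
by case: (\tr (X *m A)) (\tr (X *m B)) => x y [x' y'].
Qed.

(** Nondegeneracy of the metric without computing its spectrum: testing
    against Y = R_rho [G - G'] shows that <G - G', G> = <G - G', G'>. *)
Lemma bkm_inj rho (G G' : mat) : density rho -> herm0 G -> herm0 G' ->
  (forall Y, herm0 Y -> bkm rho G Y = bkm rho G' Y) -> G = G'.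
Proof.
move=> dr hG hG' eqG; apply/eqP; rewrite -subr_eq0; apply/eqP.
have hZ : herm (G - G') by apply: hermD; [case: hG|apply: hermN; case: hG'].
apply: (herm_mxip_eq0 hZ); rewrite mxipBr; apply/eqP; rewrite subr_eq0.
rewrite -(bkm_replicator _ dr hG) -(bkm_replicator _ dr hG') bkmC eqG.
  by rewrite bkmC.
exact: replicator_herm0.
Qed.

Lemma is_grad_density_unique (f : mat -> R) rho G G' : density rho ->
  is_grad_density f rho G -> is_grad_density f rho G' -> G = G'.
Proof.
move=> dr [hG gG] [hG' gG']; apply: (bkm_inj dr hG hG') => Y hY.
pose F s := rho + s%:C *: Y.
have F0 : F 0 = rho by rewrite /F scale0r addr0.
have dG := gG Y hY F F0 (density_line dr hY) (mxderiv_line rho Y).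
have dG' := gG' Y hY F F0 (density_line dr hY) (mxderiv_line rho Y).
by rewrite -(@derive_val _ _ _ _ _ _ _ dG) -(@derive_val _ _ _ _ _ _ _ dG').
Qed.

Lemma bkm0r rho (X : mat) : bkm rho X 0 = 0.
Proof.
rewrite /bkm; under eq_Rintegral do rewrite mulmx0 mul0mx raddf0.
by rewrite Rintegral_cst// mul0r.
Qed.

(** A curve in the i-th factor is a curve in the product that is constant in the
    other factors, and its velocity pairs with G through the component G i
    alone. *)
Lemma is_gradQ_slice (f : field -> R) (nu G : field) i : densityQ nu ->
  is_gradQ f nu G -> is_grad_density (slice f nu i) (nu i) (G i).
Proof.
move=> dn [hG gG]; split; first exact: hG.
move=> Y hY F F0 dF vF.
(* The velocity of the extended curve is Y in the i-th factor, 0 elsewhere. *)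
pose upd (g : field) (X : mat) : field := @dfwith V (fun=> mat) g i X.
have updE g X j : upd g X j = if i == j then X else g j.
  rewrite /upd; case: eqVneq => [<-|ij]; first exact: dfwithin.
  exact: dfwithout.
have hY' : herm0Q (upd (fun=> 0) Y).
  move=> j; rewrite updE; case: eqP => // _.
  by split; [exact: herm_0|rewrite raddf0].
have := gG _ hY' (fun s => upd nu (F s)).
have -> : bkmQ nu G (upd (fun=> 0) Y) = bkm (nu i) (G i) Y.
  rewrite /bkmQ (bigD1 i)//= updE eqxx big1 ?addr0// => j ji.
  by rewrite updE eq_sym (negbTE ji) bkm0r.
apply.
- by apply/funext => j; rewrite updE F0; case: eqP => // ->.
- apply: filterS dF => s dFs j; rewrite updE.
  by case: eqP => _; [exact: dFs|exact: (dn j)].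
- move=> j; rewrite updE; case: (eqVneq i j) => ij.
    by under eq_fun do rewrite updE ij eqxx.
  under eq_fun do rewrite updE (negbTE ij).
  move=> a b; rewrite !mxE; split; apply/deriv_withinTE; exact: is_derive_cst.
Qed.

Lemma is_gradQ_unique (f : field -> R) (nu G G' : field) : densityQ nu ->
  is_gradQ f nu G -> is_gradQ f nu G' -> G = G'.
Proof.
move=> dn gG gG'; apply/funext => i; apply: is_grad_density_unique (dn i) _ _.
  exact: is_gradQ_slice gG.
exact: is_gradQ_slice gG'.
Qed.

(** * The gradient of the potential *)

Lemma ipQC (A B : field) : ipQ A B = ipQ B A.
Proof. by apply: eq_bigr => i _; rewrite mxipC. Qed.

Lemma herm_Omega (E : rel V) (w : V -> V -> R) (A : field) :
  hermQ A -> hermQ (Omega E w A).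
Proof.
move=> hA i; rewrite /Omega; elim/big_ind : _ => [|X Y|k _].
- exact: herm_0.
- exact: hermD.
- by apply: hermZ; exact: hA.
Qed.

Lemma derivQ_Omega (E : rel V) (w : V -> V -> R) (F : R -> field) t Y :
  derivQ_within setT F t Y ->
  derivQ_within setT (fun s => Omega E w (F s)) t (Omega E w Y).
Proof.
move=> dF i a b.
have ReE (A : field) : Re (Omega E w A i a b) =
    \sum_(k in nbhd E i) w i k * Re (A k a b).
  rewrite /Omega summxE Re_sum; apply: eq_bigr => k _.
  by rewrite mxE mulrC ReMr mulrC.
have ImE (A : field) : Im (Omega E w A i a b) =
    \sum_(k in nbhd E i) w i k * Im (A k a b).
  rewrite /Omega summxE Im_sum; apply: eq_bigr => k _.
  by rewrite mxE mulrC ImMr mulrC.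
split; apply/deriv_withinTE.
  rewrite ReE; under eq_fun do rewrite ReE.
  apply: is_derive_bigsum => k; have [/deriv_withinTE d _] := dF k a b.
  exact: (is_deriveZ (w i k) d).
rewrite ImE; under eq_fun do rewrite ImE.
apply: is_derive_bigsum => k; have [_ /deriv_withinTE d] := dF k a b.
exact: (is_deriveZ (w i k) d).
Qed.

(** Self-adjointness merges the two terms of the product rule, which cancels the
    factor 1/2: the derivative of J along Y is - <Y, Omega [nu]>, and
    [bkm_replicator] converts it into a BKM pairing. *)
Lemma is_gradQ_potential (E : rel V) (w : V -> V -> R) (nu : field) :
  (forall A B : field, hermQ A -> hermQ B ->
     ipQ A (Omega E w B) = ipQ (Omega E w A) B) ->
  densityQ nu ->
  is_gradQ (potential E w) nu (fun i => - replicatorQ nu (Omega E w nu) i).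
Proof.
move=> sa dn.
have hn : hermQ nu by move=> i; have [[]] := dn i.
have gE i : - replicatorQ nu (Omega E w nu) i =
    replicator (nu i) (- Omega E w nu i).
  by rewrite replicatorN.
split=> [i|Y hY F F0 _ vF].
  rewrite gE; apply: replicator_herm0 => //.
  by apply: hermN; exact: herm_Omega.
have hY' : hermQ Y by move=> i; have [] := hY i.
have dip : is_derive (0 : R) 1 (fun s => ipQ (F s) (Omega E w (F s)))
    (\sum_i (mxip (Y i) (Omega E w (F 0) i) + mxip (F 0 i) (Omega E w Y i))).
  apply: is_derive_bigsum => i; apply: is_derive_mxip; first exact: vF.
  exact: (derivQ_Omega E w vF i).
apply: (is_derive_eq (is_deriveN (is_deriveZ 2^-1 dip))).
rewrite big_split/= F0 -/(ipQ Y _) -/(ipQ nu _) (sa nu Y hn hY') ipQC.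
rewrite /GRing.scale/= -mulr2n -[X in 2^-1 * X]mulr_natl mulKf ?pnatr_eq0//.
rewrite /bkmQ /ipQ -sumrN; apply: eq_bigr => i _; rewrite gE.
by rewrite (bkm_replicator _ (dn i) (hY i)) [RHS]mxipC mxipNr mxipC.
Qed.

End Gradients.

(** * The replicator flow is a gradient flow *)

Theorem proposition4p17 (R : realType) (c : nat)
    (V : finType) (E : rel V) (w : V -> V -> R) (D : V -> 'M[R[i]]_c)
    (w_ge0 : forall i k, 0 <= w i k)
    (w_supp : forall i k, k \notin nbhd E i -> w i k = 0)
    (w_sum1 : forall i, \sum_(k in nbhd E i) w i k = 1)
    (D_herm : hermQ D)
    (Omega_selfadjoint : forall mu rho : V -> 'M[R[i]]_c,
       hermQ mu -> hermQ rho ->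
       ipQ mu (Omega E w rho) = ipQ (Omega E w mu) rho)
    (I : set R) (I_itv : is_interval I) (I0 : I 0)
    (mu : R -> V -> 'M[R[i]]_c)
    (mu_density : forall t, I t -> densityQ (mu t))
    (mu_init : mu 0 = similarity E w D (@barycenterQ R c V))
    (mu_flow : forall t, I t ->
       derivQ_within I mu t (replicatorQ (mu t) (Omega E w (mu t)))) :
  let J : (V -> 'M[R[i]]_c) -> R := potential E w in
  (forall nu : V -> 'M[R[i]]_c, densityQ nu ->
     is_gradQ J nu (gradQ J nu) /\
     forall i, is_grad_density (slice J nu i) (nu i)
                 (grad_density (slice J nu i) (nu i)) /\
               gradQ J nu i = grad_density (slice J nu i) (nu i)) /\
  (forall t, I t ->
     derivQ_within I mu t (fun i => - gradQ J (mu t) i)).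
Proof.
move=> J.
have gradJ nu : densityQ nu ->
    gradQ J nu = (fun i => - replicatorQ nu (Omega E w nu) i).
  move=> dn; have gJ := is_gradQ_potential Omega_selfadjoint dn.
  by apply: xget_unique => // G; move/is_gradQ_unique; apply.
split=> [nu dn|t It].
  have gJ : is_gradQ J nu (gradQ J nu).
    by rewrite gradJ//; exact: is_gradQ_potential.
  split=> // i; have gi := is_gradQ_slice i dn gJ.
  have -> : grad_density (slice J nu i) (nu i) = gradQ J nu i.
    by apply: xget_unique => // G gG; exact: is_grad_density_unique gG gi.
  by [].
rewrite gradJ; last exact: mu_density.
under eq_fun do rewrite opprK.
exact: mu_flow.
Qed.
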